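(* A multimeasure $N:\Sigma\to c(X)$ has a finite control measure if and only if it satisfies the countable chain condition. Moreover, in this case there exists a control measure $\mu$ equivalent to $N$, i.e. a finite nonnegative measure $\mu$ on $\Sigma$ such that for $E\in\Sigma$: $\mu(E)=0$ if and only if $N(F)=\{0\}$ for every $F\in\Sigma$ with $F\subseteq E$.
   Context: $(\Omega,\Sigma)$ is a measurable space and $X$ is a Hausdorff locally convex space with dual $X'$. $c(X)$ is the family of nonempty closed convex subsets of $X$; $s(x',C)=\sup\{\langle x',x\rangle:x\in C\}$. A multimeasure is a map $N:\Sigma\to c(X)$ such that for every $x'\in X'$ the set function $s(x',N(\cdot))$ is a $\sigma$-finite countably additive measure with values in $(-\infty,+\infty]$. $\mathcal N(N)=\{E\in\Sigma:N(E)=\{0\}\}$. A control measure for $N$ is a finite nonnegative measure $\mu$ on $\Sigma$ such that $\mu(E)=0$ implies $N(E)=\{0\}$. $N$ satisfies the countable chain condition if every family of pairwise disjoint sets in $\Sigma\setminus\mathcal N(N)$ is at most countable. *)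

(* Defs.v *)
From HB Require Import structures.
From mathcomp Require Import all_boot all_order all_algebra.
From mathcomp Require Import all_classical all_reals all_analysis.

Set Implicit Arguments.
Unset Strict Implicit.
Unset Printing Implicit Defensive.
Import Order.TTheory GRing.Theory Num.Theory.
Import numFieldNormedType.Exports numFieldTopology.Exports.

Local Open Scope classical_set_scope.
Local Open Scope ring_scope.

(* X : a (real) locally convex space: [tvsType R] is MathComp-Analysis'
   interface for locally convex topological vector spaces; Hausdorffness
   is an explicit hypothesis of the theorem. *)

Definition in_dual (R : realType) (X : tvsType R) (f : X -> R) : Prop :=
  (forall x y : X, f (x + y) = f x + f y) /\
  (forall (a : R) (x : X), f (a *: x) = a * f x) /\
  continuous f.

Definition in_cX (R : realType) (X : tvsType R) (C : set X) : Prop :=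
  C !=set0 /\ closed C /\ convex_set (C : set (convex_lmodType X)).

Definition supp_fun (R : realType) (X : tvsType R) (f : X -> R) (C : set X)
  : \bar R := ereal_sup [set (f x)%:E | x in C].

Definition multimeasure (d : measure_display) (T : measurableType d)
    (R : realType) (X : tvsType R) (N : set T -> set X) : Prop :=
  (forall E, measurable E -> in_cX (N E)) /\
  forall f : X -> R, in_dual f ->
    (forall E, measurable E -> supp_fun f (N E) != -oo%E) /\
    semi_sigma_additive (fun E => supp_fun f (N E)) /\
    sigma_finite setT (fun E => supp_fun f (N E)).

Definition control_measure (d : measure_display) (T : measurableType d)
    (R : realType) (X : tvsType R) (N : set T -> set X)
    (mu : {finite_measure set T -> \bar R}) : Prop :=
  forall E, measurable E -> mu E = 0%E -> N E = [set 0].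

Definition ccc (d : measure_display) (T : measurableType d)
    (R : realType) (X : tvsType R) (N : set T -> set X) : Prop :=
  forall F : set (set T),
    (forall E, F E -> measurable E /\ N E <> [set 0]) ->
    (forall A B, F A -> F B -> A <> B -> A `&` B = set0) ->
    countable F.

(* Main.v *)
(* By Hahn-Banach the dual of X separates points, so N(E) = {0} exactly when all
   the scalar measures s(f, N(.)) vanish at E. Let M be the set of finite measures
   vanishing on every E all of whose measurable subsets F satisfy N(F) = {0}. Each
   s(f, N(.)), being a sigma-finite signed measure, is detected by the Jordan parts
   of its restrictions to sets of finite measure, and these belong to M; hence
   those E are exactly the common null sets of M. Under the chain condition,
   countably many pairwise disjoint sets, on each of which some single member of M
   already has the null sets of the whole family, exhaust T; a weighted sum of the
   corresponding restrictions is the control measure.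
   Hahn-Banach is obtained without gauges: if B is a convex neighbourhood of 0 not
   containing x, a maximal convex cone that contains x - B but not -x is a total
   vector preorder with order unit x, and the associated order functional f is
   linear with f x = 1 and f <= 1 on B. *)
Require Import Defs.
From HB Require Import structures.
From mathcomp Require Import all_boot all_order all_algebra.
From mathcomp Require Import all_classical all_reals all_analysis.
From mathcomp Require Import finmap ring lra.

Import Order.TTheory GRing.Theory Num.Theory.
Import numFieldNormedType.Exports numFieldTopology.Exports.
Local Open Scope classical_set_scope.
Local Open Scope ring_scope.

(** * Hahn-Banach separation through total vector preorders *)

(** A convex cone, read as the nonnegative vectors of a vector preorder. *)
Definition wedge {R : realType} {V : lmodType R} (A : set V) : Prop :=
  (forall u v, A u -> A v -> A (u + v)) /\
  (forall a u, 0 <= a -> A u -> A (a *: u)).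

Lemma ex_total_wedge {R : realType} {V : lmodType R} (K0 : set V) (x : V) :
  wedge K0 -> K0 x -> ~ K0 (- x) ->
  exists K, [/\ wedge K, K0 `<=` K, ~ K (- x) & forall y, K y \/ K (- y)].
Proof.
move=> wK0 K0x K0Nx.
pose good (A : set V) := [/\ wedge A, K0 `<=` A & ~ A (- x)].
(* [set0] is admitted because [Zorn_bigcup] also quantifies over the empty chain. *)
have [F FP totF|K [PK maxK]] := @Zorn_bigcup V (fun A => A = set0 \/ good A).
  have [->|/set0P[y [A FA Ay]]] := eqVneq (\bigcup_(A in F) A) set0; [by left|right].
  have goodF B z : F B -> B z -> good B.
    by move=> FB Bz; have [B0|//] := FP _ FB; move: Bz; rewrite B0.
  split; first split.
  - move=> u v [B FB Bu] [C FC Cv].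
    have [[BD _] _ _] := goodF _ _ FB Bu; have [[CD _] _ _] := goodF _ _ FC Cv.
    by have [BC|CB] := totF _ _ FB FC; [exists C => //; apply/CD => //; exact: BC
      |exists B => //; apply/BD => //; exact: CB].
  - move=> a u a0 [B FB Bu]; exists B => //.
    by have [[_ BZ] _ _] := goodF _ _ FB Bu; exact: BZ.
  - by move=> z K0z; exists A => //; have [_ + _] := goodF _ _ FA Ay; exact.
  - by move=> [B FB BNx]; have [_ _] := goodF _ _ FB BNx; exact.
have good0 : good K0 by split.
have [[KD KZ] K0K KNx] : good K.
  case: PK => // K_0; exfalso; apply: (maxK K0); last by right.
  by rewrite K_0; split=> // /(_ _ K0x).
exists K; split=> // y; apply: contrapT => /not_orP[Ky KNy].
have Kx := K0K _ K0x.
have K00 : K 0 by rewrite -(scale0r x); exact: KZ.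
(* Adjoin the ray of [y] to [K]. If [- x - t *: y] were in [K] with [t > 0], adding [x] and
   rescaling would put [- y] in [K]. *)
apply: (maxK [set z | exists2 t, 0 <= t & K (z - t *: y)]).
  split; first by move=> z Kz; exists 0; rewrite ?scale0r ?subr0.
  by move=> /(_ y) yK; apply/Ky/yK; exists 1; rewrite ?scale1r ?subrr.
right; split.
- split.
    move=> u v [s s0 us] [t t0 vt]; exists (s + t); first exact: addr_ge0.
    by rewrite scalerDl opprD addrACA; exact: KD.
  move=> a u a0 [s s0 us]; exists (a * s); first exact: mulr_ge0.
  by rewrite -scalerA -scalerBr; exact: KZ.
- by move=> z K0z; exists 0; rewrite ?scale0r ?subr0//; exact: K0K.
- move=> [t]; rewrite le_eqVlt => /predU1P[<-|t0]; first by rewrite scale0r subr0.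
  move=> /(KD _ _ Kx); rewrite addrA subrr add0r => /(KZ t^-1).
  by rewrite invr_ge0 ltW// scalerN scalerA mulVf ?gt_eqF// scale1r => /(_ isT).
Qed.

(* [f y] is the supremum of the s such that [y - s x] is in K. *)
Lemma total_wedge_functional {R : realType} {V : lmodType R} (K : set V) (x : V) :
  wedge K -> ~ K (- x) -> (forall y, K y \/ K (- y)) ->
  (forall y, exists t, K (t *: x + y)) ->
  exists f : V -> R,
    [/\ forall u v, f (u + v) = f u + f v, forall a u, f (a *: u) = a * f u,
      f x = 1 & forall y, K y -> 0 <= f y].
Proof.
move=> [KD KZ] KNx Ktot Kunit.
have Kx : K x by case: (Ktot x).
have KZN a : K (a *: x) -> 0 <= a.
  move=> Kax; rewrite leNgt; apply/negP => a0; apply: KNx.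
  have := KZ (- a^-1) _ _ Kax; rewrite oppr_ge0 invr_le0 ltW// => /(_ isT).
  by rewrite scalerA mulNr mulVf ?lt_eqF// scaleN1r.
(* A Dedekind cut: both sides are strict, so nothing is claimed at [s = c]. The algebraic laws of
   [f] follow by checking the two halves and uniqueness. *)
pose cut y c := (forall s, s < c -> K (y - s *: x)) /\
                (forall s, c < s -> K (s *: x - y)).
have cut_le y c d : cut y c -> cut y d -> d <= c.
  move=> [_ yc] [dy _]; rewrite leNgt; apply/negP => cd.
  (* Two points strictly between [c] and [d]; the two memberships add up to a negative multiple of
     [x] in [K]. *)
  have /yc + : c < c + (d - c) / 3 by lra.
  have /dy h : c + (d - c) / 3 * 2 < d by lra.
  move=> /(KD _ _ h); rewrite addrC addrA subrK -scalerBl => /KZN; lra.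
have cut_uniq y c d : cut y c -> cut y d -> c = d.
  by move=> yc yd; apply/eqP; rewrite eq_le !(@cut_le y).
have cut_ex y : exists c, cut y c.
  pose S := [set s | K (y - s *: x)].
  have supS : has_sup S.
    split; first by have [t] := Kunit y; exists (- t); rewrite /S/= scaleNr opprK addrC.
    have [t Kt] := Kunit (- y); exists t => s /= /(KD _ _ Kt).
    rewrite addrA subrK -scalerBl => /KZN; lra.
  exists (sup S); split=> s.
    move=> /(sup_gt supS.1)[s' /= Ks' ss'].
    have -> : y - s *: x = (y - s' *: x) + (s' - s) *: x.
      by rewrite scalerBl addrA subrK.
    by apply: KD => //; apply: KZ => //; lra.
  move=> ss; case: (Ktot (s *: x - y)) => //; rewrite opprB => Ks.
  have : s <= sup S by apply: sup_upper_bound.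
  by rewrite leNgt ss.
have [f fP] := choice cut_ex.
have fE y c : cut y c -> f y = c by exact/cut_uniq/fP.
have fD u v : f (u + v) = f u + f v.
  apply: fE; have [u1 u2] := fP u; have [v1 v2] := fP v; split=> s hs.
    pose e := (f u + f v - s) / 2.
    have -> : u + v - s *: x = (u - (f u - e) *: x) + (v - (f v - e) *: x).
      by rewrite addrACA -opprD -scalerDl; congr (_ - _ *: _); rewrite /e; lra.
    by apply: KD; [apply: u1|apply: v1]; rewrite /e; lra.
  pose e := (s - f u - f v) / 2.
  have -> : s *: x - (u + v) = ((f u + e) *: x - u) + ((f v + e) *: x - v).
    by rewrite addrACA -opprD -scalerDl; congr (_ *: _ - _); rewrite /e; lra.
  by apply: KD; [apply: u2|apply: v2]; rewrite /e; lra.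
have fN u : f (- u) = - f u.
  apply: fE; have [u1 u2] := fP u; split=> s hs.
    have -> : - u - s *: x = (- s) *: x - u by rewrite scaleNr addrC.
    by apply: u2; lra.
  have -> : s *: x - - u = u - (- s) *: x by rewrite opprK scaleNr opprK addrC.
  by apply: u1; lra.
have fZp a u : 0 < a -> f (a *: u) = a * f u.
  move=> a0; apply: fE; have [u1 u2] := fP u.
  have sE s : s = a * (a^-1 * s) by rewrite mulrA divff ?gt_eqF// mul1r.
  split=> s hs; rewrite (sE s) -scalerA -scalerBr; apply: KZ; rewrite ?ltW//.
    by apply: u1; rewrite mulrC ltr_pdivrMr// mulrC.
  by apply: u2; rewrite mulrC ltr_pdivlMr// mulrC.
exists f; split=> //.
- move=> a u; have [a0|a0|->] := ltgtP a 0.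
  + by rewrite -{1}[a]opprK scaleNr fN fZp ?oppr_gt0// mulNr opprK.
  + exact: fZp.
  + by rewrite scale0r mul0r; have := fD 0 0; rewrite addr0; lra.
- apply: fE; split=> s hs.
    have -> : x - s *: x = (1 - s) *: x by rewrite scalerBl scale1r.
    by apply: KZ => //; lra.
  have -> : s *: x - x = (s - 1) *: x by rewrite scalerBl scale1r.
  by apply: KZ => //; lra.
- move=> y Ky; rewrite leNgt; apply/negP => fy0.
  have [_ /(_ (f y / 2))] := fP y; have h : f y < f y / 2 by lra.
  move=> /(_ h) /KD /(_ Ky); rewrite subrK => /KZN; lra.
Qed.

Lemma dual_separates_points {R : realType} (X : tvsType R) (x : X) :
  hausdorff_space X -> x != 0 -> exists2 f : X -> R, in_dual f & f x != 0.
Proof.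
move=> hX x0.
have [B [B0 Bx cB]] : exists B : set X,
    [/\ nbhs 0 B, ~ B x & convex_set (B : set (convex_lmodType X))].
  move: hX; rewrite open_hausdorff => /(_ _ _ x0)[[U V] /= [xU V0] [_ oV UV0]].
  have [BB cBB [oBB]] := @locally_convex R X.
  move=> /(_ 0 V) [|B [BBB B0] BV].
    by apply: open_nbhs_nbhs; split=> //; exact: set_mem.
  exists B; split.
  - by apply: open_nbhs_nbhs; split=> //; exact: oBB.
  - move=> /BV Vx; move/eqP : UV0; apply/eqP/set0P; exists x; split=> //.
    exact: set_mem.
  - exact/cBB/mem_set.
have conv2 u v (t : R) : 0 <= t -> t <= 1 -> B u -> B v -> B (t *: u + (1 - t) *: v).
  by move=> t0 t1 /mem_set Bu /mem_set Bv; exact: set_mem (cB _ _ (Itv01 t0 t1) Bu Bv).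
have B_0 : B 0 by exact: nbhs_singleton.
have absorb y : exists2 r : R, 0 < r & B (r *: y).
  have := @scale_continuous R X (0, y) B; rewrite /= scale0r => /(_ B0)[[U V]/= [U0 Vy] UVB].
  have /nbhs_ballP[e /= e0 eU] := U0.
  exists (e / 2); first by rewrite divr_gt0.
  apply: (UVB (e / 2, y)); split=> /=; last exact: nbhs_singleton.
  by apply: eU; rewrite /ball/= sub0r normrN gtr0_norm; lra.
pose K0 : set X := [set z | exists t b, [/\ 0 <= t, B b & z = t *: (x - b)]].
have K0x : K0 x by exists 1, 0; rewrite subr0 scale1r.
have K0Nx : ~ K0 (- x).
  move=> [t [b [t0 Bb xE]]]; apply: Bx.
  have t1 : 0 < 1 + t by lra.
  (* Solving [- x = t *: (x - b)] for [x] gives a convex combination of [b] and [0], which lies in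
     [B]. *)
  have -> : x = (t / (1 + t)) *: b + (1 - t / (1 + t)) *: 0.
    rewrite scaler0 addr0 mulrC -scalerA.
    have -> : t *: b = (1 + t) *: x.
      by rewrite scalerDl scale1r -[X in X + _]opprK xE scalerBr opprB subrK.
    by rewrite scalerA mulVf ?gt_eqF// scale1r.
  apply: conv2 => //; first by rewrite divr_ge0// ltW.
  by rewrite ler_pdivrMr// mul1r; lra.
have wK0 : wedge K0.
  split; last first.
    move=> a _ a0 [t [b [t0 Bb ->]]]; exists (a * t), b.
    by rewrite scalerA; split=> //; exact: mulr_ge0.
  move=> _ _ [t [b [t0 Bb ->]]] [s [c [s0 Bc ->]]].
  have [ts|ts] := eqVneq (t + s) 0.
    exists 0, 0; have [-> ->] : t = 0 /\ s = 0 by (split; lra).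
    by rewrite !scale0r addr0.
  have ts0 : 0 < t + s by rewrite lt_neqAle eq_sym ts addr_ge0.
  exists (t + s), ((t / (t + s)) *: b + (1 - t / (t + s)) *: c); split.
  - exact: addr_ge0.
  - by apply: conv2 => //; [rewrite divr_ge0// ltW|rewrite ler_pdivrMr// mul1r; lra].
  - rewrite [in RHS]scalerBr [in RHS]scalerDr !scalerA.
    have -> : (t + s) * (t / (t + s)) = t by field.
    have -> : (t + s) * (1 - t / (t + s)) = s by field.
    by rewrite !scalerBr addrACA -opprD -scalerDl.
have [K [wK K0K KNx Ktot]] := ex_total_wedge _ _ wK0 K0x K0Nx.
have [|f [fD fZ fx fK]] := total_wedge_functional _ _ wK KNx Ktot.
  (* [x] is an order unit because [B] absorbs [- y]. *)
  move=> y; have [r r0 Br] := absorb (- y); exists r^-1.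
  have -> : r^-1 *: x + y = r^-1 *: (x - r *: - y).
    by rewrite scalerBr scalerA mulVf ?gt_eqF// scale1r opprK.
  by apply: K0K; exists r^-1, (r *: - y); rewrite invr_ge0 ltW.
exists f; last by rewrite fx oner_neq0.
have fN u : f (- u) = - f u by rewrite -scaleN1r fZ mulN1r.
have fB b : B b -> f b <= 1.
  move=> Bb; have : K (x - b) by apply: K0K; exists 1, b; rewrite scale1r.
  by move=> /fK; rewrite fD fN fx subr_ge0.
split=> //; split=> // y; apply/cvgrPdist_lt => e e0.
have e2 : e / 2 != 0 by rewrite gt_eqF// divr_gt0.
(* Since [f <= 1] on [B], [|f| <= 1] on the intersection of [B] and [- B]; scaling that
   neighbourhood by [e / 2] and translating it to [y] gives continuity at [y]. *)
apply: filterS (nbhsT y (nbhs0Z e2 (filterI B0 (nbhs0N B0)))).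
move=> _ [_ [u [Bu [v Bv vu]] <-] <-].
rewrite fD fZ opprD addrA subrr add0r normrN normrM gtr0_norm ?divr_gt0//.
have : `|f u| <= 1.
  by rewrite ler_norml fB// andbT lerNl -fN -vu opprK fB.
move=> fu; rewrite (@le_lt_trans _ _ (e / 2))//; last by lra.
by rewrite ler_piMr// divr_ge0// ltW.
Qed.

(** * Null sets of families of finite measures *)

Lemma measure_bigcup_eq0 d (T : sigmaRingType d) (R : realFieldType)
    (mu : {measure set T -> \bar R}) (F : (set T)^nat) :
  (forall k, measurable (F k)) -> (forall k, mu (F k) = 0%E) ->
  mu (\bigcup_k F k) = 0%E.
Proof.
move=> mF F0; apply/negligibleP; first exact: bigcup_measurable.
by apply: negligible_bigcup => k; apply/negligibleP; [exact: mF|exact: F0].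
Qed.

Lemma measure_eq0_sub d (T : ringOfSetsType d) (R : realFieldType)
    (mu : {measure set T -> \bar R}) (A B : set T) :
  measurable A -> measurable B -> A `<=` B -> mu B = 0%E -> mu A = 0%E.
Proof.
move=> mA mB AB B0; apply/eqP; rewrite eq_le measure_ge0 andbT -B0.
by apply: le_measure => //; exact: mem_set.
Qed.

Lemma ex_finite_measure_series d (T : measurableType d) (R : realType)
    (nu : nat -> {finite_measure set T -> \bar R}) :
  exists mu : {finite_measure set T -> \bar R}, forall E, measurable E ->
    mu E = 0%E <-> forall k, nu k E = 0%E.
Proof.
(* With these weights the [k]-th term has total mass at most [2 ^- k.+1], so the series has mass at
   most 1; positive weights keep the null sets. *)
pose w (k : nat) : R := (2 ^ k.+1)%:R^-1 / (1 + fine (nu k setT)).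
have nu0 k : 0 <= fine (nu k setT) by exact: fine_ge0.
have w_gt0 k : 0 < w k.
  by rewrite divr_gt0 ?invr_gt0 ?ltr0n ?expn_gt0//; have := nu0 k; lra.
pose wnu k := mscale (NngNum (ltW (w_gt0 k))) (nu k).
have wnuE k E : wnu k E = ((w k)%:E * nu k E)%E by [].
pose m := mseries wnu 0.
have fin : fin_num_fun m.
  apply: lty_fin_num_fun; apply: (@le_lt_trans _ _ 1%E); last exact: ltry.
  have := @epsilon_trick0 R 1 xpredT ler01; apply: le_trans.
  apply: lee_nneseries => [//|k _]; rewrite [leLHS]wnuE.
  rewrite -[X in (_ * X)%E]fineK ?fin_num_measure// -EFinM lee_fin.
  rewrite /w mul1r -mulrA ler_piMr ?invr_ge0// mulrC ler_pdivrMr; have := nu0 k; lra.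
exists (HB.pack_for {finite_measure set T -> \bar R} m
  (Measure_isFinite.Build d T R m fin)) => E mE /=; split=> [mE0 k|nuE0].
  have : (wnu k E <= m E)%E.
    rewrite /m /mseries (@nneseriesD1 _ _ k)//.
    by rewrite leeDl// nneseries_ge0.
  rewrite mE0 wnuE => h.
  have : ((w k)%:E * nu k E)%E == 0%E by rewrite eq_le h mule_ge0// lee_fin ltW.
  by rewrite mule_eq0 eqe gt_eqF//= => /eqP.
by apply: eseries0 => k _ _; rewrite [LHS]wnuE nuE0 mule0.
Qed.

(** A maximal disjoint subfamily of [P] is countable, and a nonempty member of [P] missing its union
    could be added to it. *)
Lemma ex_exhausting_seq {T : Type} (P : set (set T)) :
  (forall F, F `<=` P -> trivIset F id -> countable F) ->
  exists G : nat -> set T, (forall k, P (G k) \/ G k = set0) /\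
    forall A, P A -> A !=set0 -> A `&` \bigcup_k G k !=set0.
Proof.
move=> cccP; have [Q [QP tQ maxQ]] := ex_maximal_disjoint_subcollection id P.
have /countable_injP[f finj] := cccP _ QP tQ.
pose G k := [set x | exists A, [/\ Q A, f A = k & A x]].
have GE A : Q A -> G (f A) = A.
  move=> QA; apply/seteqP; split=> x; last by exists A.
  by move=> [B [QB /finj BA Bx]]; rewrite -(BA _ _)//; exact: mem_set.
have QG A : Q A -> A `<=` \bigcup_k G k.
  by move=> QA; rewrite -{1}(GE _ QA); exact: bigcup_sup.
exists G; split.
  move=> k; have [->|/set0P[x [A [QA <- _]]]] := eqVneq (G k) set0; first by right.
  by left; rewrite GE//; exact: QP.
move=> A PA [a Aa]; apply/set0P/negP => /eqP AG.
have NQA : ~ Q A.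
  by move=> /QG /(_ _ Aa) Ga; have : (A `&` \bigcup_k G k) a by []; rewrite AG.
have AQ0 B : Q B -> A `&` B = set0.
  move=> QB; rewrite -subset0 -AG; apply: setIS; exact: QG.
apply: (maxQ (A |` Q)).
- by split; [move=> B QB; right|move=> /(_ A) h; apply/NQA/h; left].
- by move=> B [->|/QP].
- move=> B C [->|QB] [->|QC] //=.
  + by rewrite AQ0// => /set0P/eqP.
  + by rewrite setIC AQ0// => /set0P/eqP.
  + exact: tQ.
Qed.

(* Exhaust T by countably many sets on each of which a single member of M has
   the same null sets as the whole family. *)
Lemma ccc_ex_equivalent_measure d (T : measurableType d) (R : realType)
    (M : set {finite_measure set T -> \bar R}) :
  (forall F : set (set T),
     (forall E, F E -> measurable E /\ exists2 l, M l & l E <> 0%E) ->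
     trivIset F id -> countable F) ->
  exists mu : {finite_measure set T -> \bar R}, forall E, measurable E ->
    mu E = 0%E <-> forall l, M l -> l E = 0%E.
Proof.
move=> cccM.
(* On [A], every member of [M] is absolutely continuous with respect to [l0]. *)
pose dom (l0 : {finite_measure set T -> \bar R}) (A : set T) :=
  forall H, measurable H -> H `<=` A -> l0 H = 0%E -> forall l, M l -> l H = 0%E.
have ex_dom l0 E : M l0 -> measurable E -> l0 E <> 0%E ->
    exists F, [/\ measurable F, F `<=` E, l0 F <> 0%E & dom l0 F].
  move=> Ml0 mE l0E.
  (* Remove from [E] an exhausting sequence of [l0]-null sets charged by [M]. The removed union is
     [l0]-null, and no such set is left in the remainder. *)
  pose P := [set A | [/\ measurable A, A `<=` E, l0 A = 0%E &
                         exists2 l, M l & l A <> 0%E]].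
  have [|G [GP PG]] := ex_exhausting_seq P.
    by move=> F FP tF; apply: cccM => // A /FP[].
  have mG k : measurable (G k) by case: (GP k) => [[]//|->].
  have mUG : measurable (\bigcup_k G k) by exact: bigcup_measurable.
  have l0UG : l0 (\bigcup_k G k) = 0%E.
    by apply: measure_bigcup_eq0 => // k; case: (GP k) => [[]//|->].
  have mEG : measurable (E `\` \bigcup_k G k) by exact: measurableD.
  exists (E `\` \bigcup_k G k); split=> //.
    move=> l0EG; apply: l0E.
    apply: (@measure_eq0_sub _ _ _ _ _ ((E `\` \bigcup_k G k) `|` \bigcup_k G k)) => //.
    - exact: measurableU.
    - by move=> x Ex; have [Gx|NGx] := pselect ((\bigcup_k G k) x); [right|left].
    - by rewrite measureU0.
  move=> H mH HE l0H l Ml; apply: contrapT => lH.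
  have PH : P H.
    split=> //; last by exists l.
    by apply: subset_trans HE _; exact: subDsetl.
  have [|x [Hx Gx]] := PG _ PH; last by have [] := HE _ Hx.
  by apply/set0P/eqP => H0; apply: lH; rewrite H0 measure0.
pose P := [set A | measurable A /\ exists l0, [/\ M l0, l0 A <> 0%E & dom l0 A]].
have [|G [GP PG]] := ex_exhausting_seq P.
  by move=> F FP tF; apply: cccM => // A /FP[mA [l [Ml lA _]]]; split=> //; exists l.
have mG k : measurable (G k) by case: (GP k) => [[]//|->].
have mUG : measurable (\bigcup_k G k) by exact: bigcup_measurable.
(* For an empty [G k] the zero measure serves; it need not be taken from [M], so only its vanishing
   on common null sets is recorded. *)
have /choice[l lP] k : exists lk : {finite_measure set T -> \bar R},
    dom lk (G k) /\ forall E, (forall m, M m -> m E = 0%E) -> lk E = 0%E.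
  case: (GP k) => [[_ [m [Mm _ dm]]]|->].
    by exists m; split=> // E; exact.
  exists mzero; split=> // H _; rewrite subset0 => -> _ m _; exact: measure0.
have [mu muP] := ex_finite_measure_series _ _ _ (fun k => mrestr (l k) (mG k)).
exists mu => E mE; rewrite muP//; split=> [lE0 m Mm|E0 k].
- have mEG : m (E `&` \bigcup_k G k) = 0%E.
    rewrite setI_bigcupr; apply: measure_bigcup_eq0 => k.
      exact: measurableI.
    have [dl _] := lP k; apply: dl => //; [exact: measurableI|exact: lE0].
  have mED : measurable (E `\` \bigcup_k G k) by exact: measurableD.
  rewrite -(setUIDK E (\bigcup_k G k)) setUC measureU0//; last exact: measurableI.
  (* Otherwise the part of [E] outside all [G k] would contain a nonempty member of [P], against
     exhaustion. *)
  apply: contrapT => mED0.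
  have [F [mF FE mF0 dF]] := ex_dom _ _ Mm mED mED0.
  have [||x [Fx Gx]] := PG F; last by have [] := FE _ Fx.
  + by split=> //; exists m.
  + by apply/set0P/eqP => F0; apply: mF0; rewrite F0 measure0.
- have [_ lk] := lP k.
  by apply: (measure_eq0_sub _ _ _ (l k)) (lk _ E0) => //; exact: measurableI.
Qed.

(** * Sigma-finite signed measures *)

(** The series for [A, set0, set0, ...] gives [m A = m A + m set0] in the limit, and the finite
    [m A] cancels. *)
Lemma semi_sigma_additive_set0 d (T : measurableType d) (R : realType)
    (m : set T -> \bar R) (A : set T) :
  semi_sigma_additive m -> measurable A -> m A \is a fin_num -> m set0 = 0%E.
Proof.
move=> sm mA Afin.
pose F k := if k is 0 then A else set0.
have UF : \bigcup_k F k = A.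
  by apply/seteqP; split=> [x [[|k] _]//|x Ax]; exists 0%N.
have : (fun n => \sum_(0 <= i < n) m (F i))%E @ \oo --> m A.
  rewrite -UF; apply: sm; last by rewrite UF.
    by case=> [|i] /=; [exact: mA|exact: measurable0].
  by move=> [|i] [|j] _ _ //= -[x []].
(* The shift skips index 0, where the term is [m A]; from [n.+1] to [n.+2] the added term is always
   [m set0]. *)
rewrite -cvg_shiftS => Fn; have := Fn; rewrite -cvg_shiftS => Fn1.
have : (fun n => \sum_(0 <= i < n.+1) m (F i) + m set0)%E @ \oo --> (m A + m set0)%E.
  by apply: cvgeD; [exact: fin_num_adde_defr|exact: Fn|exact: cvg_cst].
have -> : (fun n => \sum_(0 <= i < n.+1) m (F i) + m set0)%E =
          [sequence (\sum_(0 <= i < n.+2) m (F i))%E]_n.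
  by apply/funext => n; rewrite /= [in RHS]big_nat_recr.
move=> /(cvg_unique (@ereal_hausdorff R) Fn1) mE.
by have := subee Afin; rewrite {1}mE addeAC subee// add0e.
Qed.

(* The values of m are finite on each piece of the cover, so m restricts to a
   charge there, and one of its two Jordan components detects F. *)
Lemma ex_finite_measure_detecting d (T : measurableType d) (R : realType)
    (m : set T -> \bar R) (F : set T) :
  (forall E, measurable E -> m E != -oo%E) -> semi_sigma_additive m ->
  sigma_finite setT m -> measurable F -> m F <> 0%E ->
  exists2 l : {finite_measure set T -> \bar R}, l F <> 0%E &
    forall E, measurable E ->
      (forall H, measurable H -> H `<=` E -> m H = 0%E) -> l E = 0%E.
Proof.
move=> mNy sm [A UA /all_and2[mA Aoo]] mF mF0.
have Afin k : m (A k) \is a fin_num by rewrite fin_numE mNy// lt_eqF// Aoo.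
have m0 : m set0 = 0%E by exact: semi_sigma_additive_set0 (Afin 0%N).
have mU := semi_additiveW m0 (semi_sigma_additive_is_additive m0 sm).
have mD k : measurable (seqDU A k) by exact: seqDU_measurable.
have [k FDk] : exists k, m (F `&` seqDU A k) <> 0%E.
  apply: contrapT => /forallNP FD0; apply: mF0.
  have : (fun n => \sum_(0 <= i < n) m (F `&` seqDU A i))%E @ \oo --> m F.
    have {2}-> : F = \bigcup_k (F `&` seqDU A k).
      by rewrite -setI_bigcupr -seqDU_bigcup_eq -UA setIT.
    apply: sm; first by move=> i; exact: measurableI.
      exact/trivIset_setIl/trivIset_seqDU.
    by apply: bigcup_measurable => i _; exact: measurableI.
  move=> /(cvg_unique (@ereal_hausdorff R)); apply.
  by apply: cvg_near_cst; apply: nearW => n; rewrite big1// => i _; apply: contrapT; exact: FD0.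
pose D := seqDU A k; pose c E := m (E `&` D).
have c0 : c set0 = 0%E by rewrite /c set0I.
(* [E] meets [D] in a subset of [A k]; its value and that of its complement in [A k] add up to the
   finite [m (A k)], so both are finite. *)
have cfin E : measurable E -> c E \is a fin_num.
  move=> mE; have mED : measurable (E `&` D) by exact: measurableI mE (mD k).
  have mAED : measurable (A k `\` (E `&` D)) by exact: measurableD.
  have EA : E `&` D `<=` A k by move=> x [_ Dx]; exact: subset_seqDU Dx.
  have : m (E `&` D `|` A k `\` (E `&` D)) \is a fin_num by rewrite setDUK.
  rewrite mU//; last 2 first.
  - exact: measurableU.
  - by rewrite setIDA setIC -setIDA setDv setI0.
  by rewrite fin_numD => /andP[].
have csig : semi_sigma_additive c.
  move=> G mG tG mUG; rewrite /c setI_bigcupl; apply: sm.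
  - by move=> i; exact: measurableI (mG i) (mD k).
  - exact: trivIset_setIr.
  - by apply: bigcup_measurable => i _; exact: measurableI (mG i) (mD k).
pose nu : (charge T R) :=
  HB.pack_for (charge T R) c (isCharge.Build d T R c c0 cfin csig).
have [P [Q PQ]] := Hahn_decomposition nu.
have [[mP _] [mQ _] _ _] := PQ.
(* Up to sign, the Jordan components of [nu] at [E] are values of [m] on measurable subsets of
   [E]. *)
have nu_null B E : measurable B -> measurable E ->
    (forall H, measurable H -> H `<=` E -> m H = 0%E) -> nu (E `&` B) = 0%E.
  move=> mB mE E0; apply: E0; last by move=> x [[]].
  by apply: measurableI (mD k); exact: measurableI.
have [posF|posF] := pselect (jordan_pos PQ F = 0%E).
  exists (jordan_neg PQ).
    move=> negF; apply: FDk; rewrite -[LHS]/(nu F) (jordan_decomp PQ mF).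
    by rewrite /cadd/= posF cscaleN1/= negF oppe0 adde0.
  move=> E mE E0; rewrite [LHS]jordan_negE cjordan_negE /crestr0 mem_set// /crestr.
  by rewrite nu_null ?oppe0.
exists (jordan_pos PQ) => // E mE E0.
by rewrite [LHS]jordan_posE cjordan_posE /crestr0 mem_set// /crestr nu_null.
Qed.

(** * Support functions and scalar detection for multimeasures *)

Lemma supp_fun_set10 {R : realType} {X : tvsType R} (f : X -> R) :
  in_dual f -> supp_fun f [set 0] = 0%E.
Proof.
move=> [fD _]; rewrite /supp_fun image_set1 ereal_sup1.
by have := fD 0 0; rewrite addr0 => f0; congr (_%:E); lra.
Qed.

(** Applied to [f] and to its negative, the hypothesis makes every dual functional vanish on [C];
    the dual separates points. *)
Lemma supp_fun_eq0_set10 {R : realType} {X : tvsType R} (C : set X) :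
  hausdorff_space X -> C !=set0 ->
  (forall f, in_dual f -> supp_fun f C = 0%E) -> C = [set 0].
Proof.
move=> hX [c Cc] C0.
have le0 f x : in_dual f -> C x -> f x <= 0.
  move=> df Cx; have : ((f x)%:E <= supp_fun f C)%E by apply: ereal_sup_ubound; exists x.
  by rewrite C0// lee_fin.
have Cx0 x : C x -> x = 0.
  move=> Cx; apply/eqP; apply: contrapT => /negP x0.
  have [f [fD [fZ fc]] fx] := dual_separates_points _ _ hX x0.
  have dNf : in_dual (fun y => - f y).
    split; first by move=> y z; rewrite fD opprD.
    split; first by move=> a y; rewrite fZ mulrN.
    by move=> y; apply: cvgN; exact: fc.
  have f1 := le0 f x (conj fD (conj fZ fc)) Cx.
  have f2 := le0 _ x dNf Cx.
  by move/eqP: fx; apply; lra.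
by apply/seteqP; split=> [x /Cx0//|_ ->]; rewrite -(Cx0 _ Cc).
Qed.

Lemma multimeasure_detect {d} {T : measurableType d} {R : realType}
    {X : tvsType R} (N : set T -> set X) (E : set T) :
  hausdorff_space X -> multimeasure N -> measurable E -> N E <> [set 0] ->
  exists2 f, in_dual f & supp_fun f (N E) <> 0%E.
Proof.
move=> hX [cN _] mE NE; apply: contrapT => Nf; apply: NE.
apply: supp_fun_eq0_set10 => //; first by have [] := cN _ mE.
by move=> f df; apply: contrapT => fE; apply: Nf; exists f.
Qed.

(** Sigma-finiteness gives each scalar measure a set of finite value, which forces the value 0 at
    [set0]. *)
Lemma multimeasure_set0 {d} {T : measurableType d} {R : realType}
    {X : tvsType R} (N : set T -> set X) :
  hausdorff_space X -> multimeasure N -> N set0 = [set 0].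
Proof.
move=> hX mN; apply: contrapT => N0.
have [f df] := multimeasure_detect _ _ hX mN measurable0 N0; apply.
have [_ /(_ _ df)[fNy [sf [A _ Aoo]]]] := mN.
have [mA A0oo] := Aoo 0%N.
apply: (semi_sigma_additive_set0 _ _ _ (fun E => supp_fun f (N E)) (A 0%N)) => //.
by rewrite fin_numE fNy// lt_eqF.
Qed.

(** * The chain condition and control measures *)

Lemma finite_measure_countable_disjoint d (T : measurableType d) (R : realType)
    (mu : {finite_measure set T -> \bar R}) (F : set (set T)) :
  (forall A, F A -> measurable A /\ mu A <> 0%E) -> trivIset F id ->
  countable F.
Proof.
move=> mF tF.
pose G n := F `&` [set A | (n.+1%:R^-1%:E <= mu A)%E].
have FG : F `<=` \bigcup_n G n.
  move=> A FA; have [mA /eqP muA] := mF _ FA.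
  have fA := fin_num_measure mu A mA.
  have muA_gt0 : 0 < fine (mu A).
    by rewrite fine_gt0// lt0e muA measure_ge0 ltey_eq fA.
  exists (Num.truncn (fine (mu A))^-1) => //; split=> //=.
  rewrite -(fineK fA) lee_fin -[leRHS]invrK lef_pV2 ?posrE ?invr_gt0//.
  exact/ltW/truncnS_gt.
apply: (@sub_countable _ _ _ (\bigcup_n G n)); first exact: subset_card_le.
apply: bigcup_countable => [|n _]; first exact: countableP.
apply: finite_set_countable; apply: contrapT => /infinite_set_fset infG.
have fT := fin_num_measure mu setT measurableT.
(* More than [mu setT * n.+1] disjoint sets, each of measure at least [1 / n.+1], would exceed the
   total mass. *)
pose K := (Num.truncn (fine (mu setT) * n.+1%:R)).+1.
have [B BG KB] := infG K.
have BF A : [set` B] A -> F A by move=> /BG[].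
have : (mu (\bigcup_(A in [set` B]) A) <= mu setT)%E.
  apply: le_measure => //; apply: mem_set => //.
  by apply: fin_bigcup_measurable => // A /BF/mF[].
rewrite measure_fin_bigcup//; last 2 first.
- by move=> A C BA BC; apply: tF; exact: BF.
- by move=> A /BF/mF[].
rewrite leNgt => /negP; apply.
apply: (@lt_le_trans _ _ (\sum_(A \in [set` B]) n.+1%:R^-1%:E)%E); last first.
  by apply: lee_fsum => // A /BG[].
rewrite fsbig_finite//= set_fsetK sumEFin big_const_seq iter_addr_0 count_predT.
rewrite -(fineK fT) lte_fin -[ltRHS]mulr_natl ltr_pdivlMr//.
apply: lt_le_trans (truncnS_gt _) _.
by rewrite ler_nat.
Qed.

Theorem theorem3p4 (d : measure_display) (T : measurableType d)
    (R : realType) (X : tvsType R) (N : set T -> set X) :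
  hausdorff_space X ->
  multimeasure N ->
  ((exists mu : {finite_measure set T -> \bar R}, control_measure N mu)
     <-> ccc N) /\
  (ccc N ->
   exists mu : {finite_measure set T -> \bar R},
     control_measure N mu /\
     forall E, measurable E ->
       (mu E = 0%E <->
        forall F, measurable F -> F `<=` E -> N F = [set 0])).
Proof.
move=> hX mN.
have N0 := multimeasure_set0 _ hX mN.
have ex_control : ccc N -> exists mu : {finite_measure set T -> \bar R},
    forall E, measurable E -> (mu E = 0%E <->
      forall F, measurable F -> F `<=` E -> N F = [set 0]).
  move=> cccN.
  pose null E := forall F, measurable F -> F `<=` E -> N F = [set 0].
  pose M := [set l : {finite_measure set T -> \bar R} |
             forall E, measurable E -> null E -> l E = 0%E].
  have [F FM tF|mu muP] := ccc_ex_equivalent_measure _ _ _ M.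
    (* A set charged by a member of [M] is not [null], so it contains some [H] with [N H <>
       [set 0]]. The chain condition for [N] applies to these [H], and [h] carries countability back
       to [F]. *)
    have /choice[h hP] A : exists H, F A -> [/\ measurable H, H `<=` A & N H <> [set 0]].
      have [FA|] := pselect (F A); last by exists set0.
      have [mA [l Ml lA]] := FM _ FA.
      have /existsNP[H /not_implyP[mH /not_implyP[HA NH]]] : ~ null A.
        by move=> nA; exact/lA/Ml.
      by exists H.
    have hI A B : F A -> F B -> A <> B -> h A `&` h B = set0.
      move=> FA FB AB; have [_ hA _] := hP _ FA; have [_ hB _] := hP _ FB.
      apply/eqP; apply: contrapT => /negP/set0P[x [hAx hBx]].
      by apply: AB; apply: tF => //; exists x; split; [exact: hA|exact: hB].
    (* Equal images of distinct members would be disjoint from themselves, hence empty, but [N set0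
       = [set 0]]. *)
    have hinj A B : F A -> F B -> h A = h B -> A = B.
      move=> FA FB hAB; apply: contrapT => AB.
      have [_ _ NA] := hP _ FA; apply: NA.
      by have := hI _ _ FA FB AB; rewrite -hAB setIid => ->.
    have /countable_injP[g ginj] : countable [set h A | A in F].
      apply: cccN => [_ [A FA <-]|_ _ [A FA <-] [B FB <-] hAB].
        by have [] := hP _ FA.
      by apply: hI => // AB; apply: hAB; rewrite AB.
    apply/countable_injP; exists (g \o h) => A B /set_mem FA /set_mem FB /= gh.
    by apply: hinj => //; apply: ginj gh; apply/mem_set; [exists A|exists B].
  exists mu => E mE; rewrite muP//; split=> [lE0 F mF FE|nE l]; last exact.
  apply: contrapT => NF.
  have [f df fF] := multimeasure_detect _ _ hX mN mF NF.
  have [_ /(_ _ df)[fNy [sf fsf]]] := mN.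
  (* This [l] is in [M]: on measurable subsets of a [null] set the scalar measure of [f] is 0. *)
  have [l lF lnull] := ex_finite_measure_detecting _ _ _ _ _ fNy sf fsf mF fF.
  apply: lF; apply: (measure_eq0_sub _ _ _ l _ E) => //; apply: lE0 => A mA nA.
  apply: lnull => // H mH HA; rewrite nA//; exact: supp_fun_set10.
have control : ccc N -> exists mu : {finite_measure set T -> \bar R},
    control_measure N mu /\
    forall E, measurable E -> (mu E = 0%E <->
      forall F, measurable F -> F `<=` E -> N F = [set 0]).
  move=> /ex_control[mu muP]; exists mu; split=> // E mE muE.
  by have /(muP _ mE) := muE; exact.
split=> //; split=> [[mu muN] F FN disjF|/control[mu [cmu _]]]; last by exists mu.
apply: (finite_measure_countable_disjoint _ _ _ mu).
  by move=> A FA; have [mA NA] := FN _ FA; split=> // /(muN _ mA).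
move=> A B FA FB /set0P/eqP AB; apply: contrapT => nAB; apply: AB.
exact: disjF.
Qed.
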